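(* Assume that the robot does not know the length $L$ of the barrier $[0,L]$ (it recognizes the end of the barrier only when reaching it). Then: (i) for any $\epsilon>0$ (sufficiently small), every online algorithm for restoring complete barrier coverage has competitive ratio at least $\frac32-\epsilon$; (ii) there is an online algorithm with competitive ratio at most $\frac32$.
   Context: Model. Sensors $s_1,\dots,s_n$ are at initial locations $x_1\le\cdots\le x_n$ on the barrier $[0,L]$. A sensor at position $x$ covers the closed interval $[x-r,x+r]$; all sensors have the same range $r>0$, and $2rn\ge L$. The sensors provide complete coverage if every point of $[0,L]$ is covered by some sensor. A mobile robot starts at position $0$ and moves along the segment. Whenever it is at the current position of a sensor it may pick that sensor up; it can carry any number of sensors simultaneously, and it may drop any carried sensor at its current position; there is no restriction on the number or direction of turns. Its trajectory is a sequence $[t_0=0,t_1,\dots,t_m]$ of points of the barrier with $t_i>t_{i-1}$ for odd $i$ and $t_i<t_{i-1}$ for even $i$, with length $\sum_{i=1}^m|t_i-t_{i-1}|$. The robot must finish with the sensors in positions providing complete coverage of $[0,L]$. Offline optimum. An optimal offline trajectory is a trajectory of minimum length among all trajectories achieving complete coverage for the given instance, with all initial sensor positions and $L$ known in advance. Online algorithms. An online robot knows the sensor range $r$ but knows about sensors only in the part of the barrier it has already travelled: it discovers the presence or absence of a sensor at position $x$ only when reaching $x$. It can remember everything it has seen. Admissible instances. Only instances in which the point $L$ is initially uncovered are considered (so every valid trajectory has length at least $L-r$). Competitive ratio. The competitive ratio of an online algorithm is the supremum, over admissible instances, of the length of the online robot's trajectory divided by the length of an optimal offline trajectory on the same ins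tance.
   Formalization: The online robot's trajectory is counted only up to the first moment of complete coverage; the robot need not recognize this moment or stop by itself. If it had to, (ii) fails: one sensor at 0 and L=r+d with small d gives an unbounded ratio. *)

(* Defs.v *)
From mathcomp Require Import all_boot all_order all_algebra.
From mathcomp Require Import all_classical all_reals all_analysis.

Set Implicit Arguments.
Unset Strict Implicit.
Unset Printing Implicit Defensive.

Import Order.TTheory GRing.Theory Num.Theory.
Local Open Scope classical_set_scope.
Local Open Scope ring_scope.

Record instance (R : realType) := Instance {
  barrier : R;      (* L: the barrier is [0, L] *)
  sensors : seq R   (* initial locations, x_1 <= ... <= x_n *)
}.

Definition well_formed (R : realType) (r : R) (I : instance R) : Prop :=
  [/\ 0 < barrier I,
      sorted <=%R (sensors I),
      (forall x, x \in sensors I -> 0 <= x <= barrier I)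
    & barrier I <= 2 * r * (size (sensors I))%:R].

Definition covers (R : realType) (r s y : R) : Prop := s - r <= y <= s + r.

Definition admissible (R : realType) (r : R) (I : instance R) : Prop :=
  well_formed r I /\
  ~ (exists2 s, s \in sensors I & covers r s (barrier I)).

(* [frontier] is the right end of the part [0, frontier] of the barrier already
   travelled, [travelled] is the length of the trajectory so far, [carried] is
   the number of sensors carried and [ground] is the multiset of positions of
   all the others, discovered or not. *)
Record config (R : realType) := Config {
  pos : R;
  frontier : R;
  travelled : R;
  carried : nat;
  ground : seq R
}.

Definition start (R : realType) (I : instance R) : config R :=
  Config 0 0 0 0 (sensors I).

(* A carried sensor is located at the robot; dropping it there is free. *)
Definition positions (R : realType) (c : config R) : seq R :=
  nseq (carried c) (pos c) ++ ground c.

Definition complete (R : realType) (r : R) (I : instance R) (c : config R)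
  : Prop :=
  forall y, 0 <= y <= barrier I -> exists2 s, s \in positions c & covers r s y.

Inductive action (R : realType) := Move of R | PickUp | Drop.

Arguments PickUp {R}.
Arguments Drop {R}.

Definition walk (R : realType) (c : config R) (z : R) : config R :=
  Config z (Num.max (frontier c) z) (travelled c + `|z - pos c|)
         (carried c) (ground c).

(* A move is cut off at 0 and at [lim]. Picking up where there is no sensor, or
   dropping with nothing in hand, has no effect. *)
Definition perform (R : realType) (lim : R) (c : config R) (a : action R)
  : config R :=
  match a with
  | Move y => walk c (Num.max 0 (Num.min y lim))
  | PickUp =>
      if pos c \in ground c then
        Config (pos c) (frontier c) (travelled c) (carried c).+1
               (rem (pos c) (ground c))
      else c
  | Drop =>
      if carried c is k.+1 then
        Config (pos c) (frontier c) (travelled c) k (pos c :: ground c)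
      else c
  end.

(* An offline trajectory, with the pick-ups and drops made along it, is a finite
   list of actions. The points t_0, ..., t_m of the trajectory are the points
   where the direction of travel changes, together with the two endpoints;
   further stops inside a leg [t_(i-1), t_i] do not change the length. *)
Definition offline_run (R : realType) (I : instance R) (p : seq (action R))
  : config R :=
  foldl (perform (barrier I)) (start I) p.

Definition offline_length (R : realType) (I : instance R) (p : seq (action R))
  : R :=
  travelled (offline_run I p).

Definition optimal_offline (R : realType) (r : R) (I : instance R)
    (p : seq (action R)) : Prop :=
  complete r I (offline_run I p) /\
  (forall q, complete r I (offline_run I q) ->
     offline_length I p <= offline_length I q).

(* What an online robot knows in configuration [c]: its own state, the sensors
   in [0, frontier c], and L provided that the end has been reached. *)
Definition observation (R : realType) : Type := (config R * option R)%type.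

Definition observe (R : realType) (I : instance R) (c : config R)
  : observation R :=
  (Config (pos c) (frontier c) (travelled c) (carried c)
          [seq x <- ground c | x <= frontier c],
   if barrier I <= frontier c then Some (barrier I) else None).

(* The next action is a function of all the past observations, latest first. *)
Definition algorithm (R : realType) : Type := seq (observation R) -> action R.

(* An online move into unknown territory stops at the first undiscovered sensor
   or at the end of the barrier, where the robot may decide anew. *)
Definition horizon (R : realType) (I : instance R) (c : config R) : R :=
  \big[Num.min/barrier I]_(x <- ground c | frontier c < x) x.

(* Configuration after [k] actions, with all the observations made. *)
Fixpoint online_run (R : realType) (A : algorithm R) (I : instance R) (k : nat)
  : config R * seq (observation R) :=
  match k with
  | 0 => (start I, [:: observe I (start I)])
  | k'.+1 =>
      let: (c, h) := online_run A I k' in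
      let c' := perform (horizon I c) c (A h) in
      (c', observe I c' :: h)
  end.

(* Every configuration the online robot goes through, including those in the
   course of a move. *)
Definition passes_through (R : realType) (A : algorithm R) (I : instance R)
    (c : config R) : Prop :=
  exists (k : nat) (z : R),
    let a := (online_run A I k).1 in
    let b := (online_run A I k.+1).1 in
    Num.min (pos a) (pos b) <= z <= Num.max (pos a) (pos b) /\ c = walk a z.

Definition completion_lengths (R : realType) (r : R) (A : algorithm R)
    (I : instance R) : set R :=
  [set travelled c | c in [set c | passes_through A I c /\ complete r I c]].

Definition restores_coverage (R : realType) (r : R) (A : algorithm R) : Prop :=
  forall I, admissible r I -> completion_lengths r A I !=set0.

(* The online trajectory ends at the first moment at which the sensors provide
   complete coverage; the robot need not be able to tell that this moment has
   come. A robot that had to be certain of it could not be competitive: with a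
   single sensor, located at 0, and L = r + d, moving the sensor to d is
   enough, whereas without having reached L the robot cannot exclude L = 2r,
   for which the sensor must go to r. *)
Definition online_length (R : realType) (r : R) (A : algorithm R)
    (I : instance R) : R :=
  inf (completion_lengths r A I).

Definition competitive_ratio (R : realType) (r : R) (A : algorithm R)
  : \bar R :=
  ereal_sup [set rho : \bar R |
    exists (I : instance R) (p : seq (action R)),
      [/\ admissible r I,
          optimal_offline r I p
        & rho = (online_length r A I / offline_length I p)%:E]].

(* Main.v *)
Require Import Defs.
From mathcomp Require Import all_boot all_order all_algebra.
From mathcomp Require Import all_classical all_reals all_analysis.
From mathcomp Require Import lra zify.
Import Order.TTheory GRing.Theory Num.Theory.
Local Open Scope ring_scope.

Set Implicit Arguments.
Unset Strict Implicit.
Unset Printing Implicit Defensive.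

(** Put T = L - r. Call y deficient when the sensors of [0, y] are too few to
    cover a neighbourhood of [0, y - r]. A trajectory restoring coverage crosses
    every y in [0, T), because no sensor lies within r of L, and crosses every
    deficient y at least twice, because a sensor has to be brought back over y.
    The online robot advances to the right, leaving sensors at r, 3r, 5r, ...;
    when it runs out of sensors it goes on until it owns enough of them to fill
    all these spots up to its position, goes back to fill them, and resumes. It
    crosses deficient points at most three times and the other points of [0, T)
    at most once, so pointwise at most 3/2 times as often as any offline robot;
    integrating the number of crossings compares the lengths.

    For the lower bound all the sensors lie at a point d much larger than r. If
    the robot first goes back to cover 0 when its frontier is X, then L is taken
    just beyond X + r: the robot travels about 3X, while 2X is enough. If it
    does not go back before 8d, then with L about 8d it travels 16d instead of
    10d. *)

(** * Integrating the number of crossings *)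

Definition legs_length (R : realType) (l : seq (R * R)) : R :=
  \sum_(e <- l) `|e.2 - e.1|.

(* The intervals swept by the legs are taken half-open, so that a leg crosses
   y exactly when one of its two ends is at most y. *)
Definition crossings (R : realType) (l : seq (R * R)) (y : R) : nat :=
  count (fun e => (e.1 <= y) != (e.2 <= y)) l.

(** Left-endpoint sums are exact for step functions constant on the half-open pieces [[u, v)] of the
    subdivision, so that lengths can be compared without integration theory. *)
Fixpoint riemann_sum (R : realType) (f : R -> R) (u : R) (s : seq R) : R :=
  if s is v :: s' then (v - u) * f u + riemann_sum f v s' else 0.

Lemma riemann_sum_lt0 (R : realType) (b u : R) (s : seq R) :
  b <= u -> path <=%R u s ->
  riemann_sum (fun y => (y < b)%R%:R) u s = 0.
Proof.
elim: s u => //= v s IH u bu /andP[uv vs].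
by rewrite IH ?(le_trans bu) // ltNge bu mulr0 addr0.
Qed.

Lemma riemann_sum_lt (R : realType) (b u : R) (s : seq R) :
  path <=%R u s -> b \in u :: s ->
  riemann_sum (fun y => (y < b)%R%:R) u s = b - u.
Proof.
elim: s u => [u _|v s IH u /= /andP[uv vs]].
  by rewrite inE => /eqP ->; rewrite subrr.
rewrite inE => /predU1P[->|bs].
  by rewrite ltxx mulr0 add0r riemann_sum_lt0 // subrr.
rewrite IH //; have [ub|bu] := ltP u b; first by rewrite mulr1; lra.
have vb : v <= b.
  by move: bs; rewrite inE => /predU1P[->//|];
    apply/allP/(order_path_min le_trans vs).
rewrite mulr0; lra.
Qed.

Lemma riemann_sumB (R : realType) (f g : R -> R) (u : R) (s : seq R) :
  riemann_sum (fun y => f y - g y) u s = riemann_sum f u s - riemann_sum g u s.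
Proof.
elim: s u => [u|v s IH u] /=; first by rewrite subr0.
by rewrite IH mulrBr; lra.
Qed.

Lemma riemann_sumD (R : realType) (f g : R -> R) (u : R) (s : seq R) :
  riemann_sum (fun y => f y + g y) u s = riemann_sum f u s + riemann_sum g u s.
Proof.
elim: s u => [u|v s IH u] /=; first by rewrite addr0.
by rewrite IH mulrDr; lra.
Qed.

Lemma eq_riemann_sum (R : realType) (f g : R -> R) (u : R) (s : seq R) :
  f =1 g -> riemann_sum f u s = riemann_sum g u s.
Proof. by move=> fg; elim: s u => //= v s IH u; rewrite IH fg. Qed.

(** For [a <= b] the integrand is the indicator of [[a, b)], a difference of two of the indicators
    summed above; the other order follows by symmetry. *)
Lemma riemann_sum_leg (R : realType) (a b u : R) (s : seq R) :
  path <=%R u s -> a \in u :: s -> b \in u :: s ->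
  riemann_sum (fun y => ((a <= y) != (b <= y))%R%:R) u s = `|b - a|.
Proof.
wlog ab : a b / a <= b.
  move=> H us ai bi; have [ab|/ltW ba] := leP a b; first exact: H.
  rewrite distrC -H //; apply: eq_riemann_sum => y; by rewrite eq_sym.
move=> us ai bi; rewrite ger0_norm ?subr_ge0 //.
rewrite (@eq_riemann_sum _ _ (fun y => (y < b)%R%:R - (y < a)%R%:R)).
  by rewrite riemann_sumB !riemann_sum_lt //; lra.
move=> y; rewrite !ltNge; case: (leP b y) => by_.
  by rewrite (le_trans ab by_) /= subrr.
by case: (leP a y) => _ /=; rewrite ?subr0 ?subrr.
Qed.

Lemma riemann_sum_crossings (R : realType) (l : seq (R * R)) (u : R)
    (s : seq R) :
  path <=%R u s ->
  (forall e, e \in l -> (e.1 \in u :: s) && (e.2 \in u :: s)) ->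
  riemann_sum (fun y => (crossings l y)%:R) u s = legs_length l.
Proof.
move=> us; elim: l => [_|e l IH els].
  rewrite /legs_length big_nil; elim: (s) u {us} => //= v s' IHs u.
  by rewrite IHs mulr0 addr0.
rewrite /legs_length big_cons -/(legs_length l) -IH; last first.
  by move=> e' e'l; apply: els; rewrite inE e'l orbT.
have /andP[e1 e2] := els e (mem_head e l).
rewrite -(riemann_sum_leg us e1 e2) -riemann_sumD.
by apply: eq_riemann_sum => y; rewrite /crossings /= natrD.
Qed.

Lemma ler_riemann_sum (R : realType) (f g : R -> R) (u : R) (s : seq R) :
  path <=%R u s -> (forall y, f y <= g y) ->
  riemann_sum f u s <= riemann_sum g u s.
Proof.
move=> us fg; elim: s u us => //= v s IH u /andP[uv vs].
by rewrite lerD ?IH // ler_wpM2l // subr_ge0.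
Qed.

Lemma riemann_sumZ (R : realType) (a : R) (f : R -> R) (u : R) (s : seq R) :
  riemann_sum (fun y => a * f y) u s = a * riemann_sum f u s.
Proof.
elim: s u => [u|v s IH u] /=; first by rewrite mulr0.
by rewrite IH mulrDr mulrCA.
Qed.

(** All end points of both lists serve as the subdivision, so that both sums are exact and can be
    compared term by term. *)
Lemma ler_legs_length (R : realType) (a b : nat) (l l' : seq (R * R)) :
  (forall y, a * crossings l y <= b * crossings l' y)%N ->
  a%:R * legs_length l <= b%:R * legs_length l'.
Proof.
move=> ll'.
pose ends := flatten [seq [:: e.1; e.2] | e <- l ++ l'].
(* The extra 0 only makes the list nonempty. *)
case Es: (sort <=%R (0 :: ends)) => [|u s].
  by have := congr1 size Es; rewrite size_sort.
have us : path <=%R u s.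
  by have := sort_sorted (@le_total _ R) (0 :: ends); rewrite Es.
have inS e : e \in l ++ l' -> (e.1 \in u :: s) && (e.2 \in u :: s).
  move=> el; rewrite -Es !mem_sort !inE; apply/andP; split; apply/orP; right;
    by apply/flattenP; exists [:: e.1; e.2];
      rewrite ?(map_f (fun e => [:: e.1; e.2])) // !inE eqxx ?orbT.
rewrite -!(@riemann_sum_crossings _ _ u s) -?riemann_sumZ //.
- by apply: ler_riemann_sum => // y; rewrite -!natrM ler_nat.
- by move=> e el; apply: inS; rewrite mem_cat el orbT.
- by move=> e el; apply: inS; rewrite mem_cat el.
Qed.

(** * Coverage by the spots r, 3r, 5r, ... *)

Definition spot (R : realType) (r : R) (i : nat) : R := i.*2.+1%:R * r.

Lemma spot0 (R : realType) (r : R) : spot r 0 = r.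
Proof. by rewrite /spot mul1r. Qed.

Lemma spotS (R : realType) (r : R) (i : nat) : spot r i.+1 = spot r i + 2 * r.
Proof. by rewrite /spot -mulrDl -natrD; congr (_%:R * _); lia. Qed.

Lemma spotE (R : realType) (r : R) (i : nat) : spot r i = 2 * r * i%:R + r.
Proof. by rewrite /spot -muln2 -natr1 natrM; lra. Qed.

Lemma ler_spot (R : realType) (r : R) (i j : nat) :
  0 < r -> (spot r i <= spot r j) = (i <= j)%N.
Proof. by move=> r0; rewrite ler_pM2r // ler_nat ltnS leq_double. Qed.

Lemma spots_cover (R : realType) (r : R) (N : nat) (s : seq R) (y : R) :
  0 < r -> {in gtn N, forall i, spot r i \in s} ->
  (0 < N)%N -> 0 <= y -> y + r <= spot r N ->
  exists2 x, x \in s & covers r x y.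
Proof.
move=> r0; elim: N => // N IH sN _ y0 yN.
have [yN'|yN'] := ltP (y + r) (spot r N).
  apply: IH => //.
  - by move=> i iN; apply: sN; rewrite inE /= ltnW.
  - by case: N yN' {sN yN} => //; rewrite spot0; lra.
  - exact: ltW.
exists (spot r N); first by apply: sN; rewrite inE /=.
by move: yN yN'; rewrite spotS /covers => *; apply/andP; split; lra.
Qed.

Lemma spots_end_cover (R : realType) (r L : R) (N : nat) (s : seq R) (y : R) :
  0 < r -> {in gtn N, forall i, spot r i \in s} ->
  L - r \in s -> L - r <= spot r N -> 0 <= y <= L ->
  exists2 x, x \in s & covers r x y.
Proof.
move=> r0 sN sL LN /andP[y0 yL].
have [yL'|yL'] := leP (L - r - r) y.
  by exists (L - r) => //; apply/andP; split; lra.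
apply: (spots_cover r0 sN) => //; last lra.
by case: N LN {sN} => //; rewrite spot0; lra.
Qed.

(** Each sensor covers a length of at most [2 * r]. In the induction a sensor [x] covering [z] is
    removed: the others cover everything to the left of [x - r]. *)
Lemma covered_le_size (R : realType) (r z : R) (s : seq R) :
  0 < r ->
  (forall y, 0 <= y <= z -> exists2 x, x \in s & covers r x y) ->
  z + r <= spot r (size s).
Proof.
move=> r0; elim: {s}(size s) {-2}s (eqxx (size s)) z => [|m IH] s.
  move=> /nilP -> z cov; rewrite spot0.
  have [z0|z0] := leP z 0; first by lra.
  by have [|x] := cov z; [lra|rewrite in_nil].
move=> /eqP sm z cov; rewrite sm.
have r1 := ler_spot 0 m r0; rewrite spot0 leq0n in r1.
have [z0|z0] := leP z 0; first by rewrite spotS; lra.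
have [|x xs xz] := cov z; first by lra.
have rs : size (rem x s) = m by rewrite size_rem // sm.
have H w : w < x - r -> w <= spot r m - r.
  move=> wx; rewrite lerBrDr -rs; apply: (IH (rem x s)); first by rewrite rs.
  move=> y /andP[y0 yw]; have [|u us uy] := cov y.
    by move: xz => /andP[]; lra.
  exists u => //; move: us;
    rewrite (perm_mem (perm_to_rem xs)) inE => /predU1P[ux|//].
  by move: uy; rewrite ux => /andP[]; lra.
(* The point [x - r] itself may be covered by [x] alone, so the bound is obtained for all smaller
   points and passed to the limit. *)
have : x - r <= spot r m - r by apply/ler_addgt0Pr => e e0;
  have := H (x - r - e); lra.
by rewrite spotS; move: xz => /andP[]; lra.
Qed.

Lemma next_above (R : realType) (y b : R) (s : seq R) : y < b ->
  exists2 v, y < v <= b & forall x, x \in s -> y < x -> v <= x.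
Proof.
move=> yb; elim: s => [|u s [v /andP[yv vb] vs]].
  by exists b => //; rewrite yb lexx.
have [yu|uy] := ltP y u.
  exists (Num.min u v); first by rewrite lt_min yu yv ge_min vb orbT.
  move=> x; rewrite inE => /predU1P[->|xs yx]; first by rewrite ge_min lexx.
  by rewrite ge_min vs // orbT.
exists v; first by rewrite yv.
by move=> x; rewrite inE => /predU1P[->|xs yx]; [rewrite ltNge uy|apply: vs].
Qed.

(** * Crossings of an offline trajectory *)

(* At most (y - r) / 2r sensors start in [0, y]: they cannot cover [0, y - r]
   together with its right neighbourhood. *)
Definition deficient (R : realType) (r : R) (I : instance R) (y : R) : bool :=
  spot r (count (fun x => x <= y)%R (sensors I)) <= y.

Lemma count_positions (R : realType) (P : pred R) (c : config R) :
  count P (positions c) = (P (pos c) * carried c + count P (ground c))%N.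
Proof. by rewrite count_cat count_nseq. Qed.

(** Picking up and dropping only regroup the multiset [positions], so statements about positions
    alone have to be checked for walks only. *)
Lemma perform_positions (R : realType) (lim : R) (c : config R) (a : action R) :
  (exists2 z, 0 <= z & perform lim c a = walk c z) \/
  [/\ pos (perform lim c a) = pos c, frontier (perform lim c a) = frontier c,
      travelled (perform lim c a) = travelled c
    & perm_eq (positions (perform lim c a)) (positions c)].
Proof.
case: a => [y||] /=; first by left; exists (Num.max 0 (Num.min y lim));
  rewrite // le_max lexx.
  right; case: ifP => // pc; split=> //; rewrite /positions /=.
  by rewrite -cat1s perm_catCA perm_cat2l perm_sym; apply: perm_to_rem.
right; case: c => p F t [|k] g //=; split=> //.
by rewrite /positions /= -(cat1s p g) perm_catCA.
Qed.

(** The parity of the crossings tells on which side of [y] the robot is. Bringing a sensor over [y]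
    to the left takes a crossing to the left, which one to the right must precede; without any
    crossing no sensor is brought to the right of [y]. *)
Lemma offline_crossings (R : realType) (I : instance R) (q : seq (action R)) :
  exists2 l, legs_length l = travelled (offline_run I q) &
  forall y, 0 <= y ->
    [/\ odd (crossings l y) = (y < pos (offline_run I q)),
        (crossings l y <= 1)%N ->
          (count (fun x => x <= y)%R (positions (offline_run I q))
             <= count (fun x => x <= y)%R (sensors I))%N
      & crossings l y = 0 ->
          {in positions (offline_run I q), forall x,
             y < x -> x \in sensors I}].
Proof.
elim/last_ind: q => [|q a [l lt lP]].
  exists [::]; first by rewrite /legs_length big_nil.
  by move=> y y0; split=> [|_|_ x //]; rewrite /= ?ltNge ?y0.
rewrite /offline_run -cats1 foldl_cat /= -/(offline_run I q).
set c := offline_run I q in lt lP *.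
have [[z _ ->]|[-> Fc -> pc]] := perform_positions (barrier I) c a; last first.
  exists l => // y y0; have [odl le1 eq0] := lP y y0; split=> //.
    by rewrite (permP pc).
  by move=> l0 x; rewrite (perm_mem pc); apply: eq0.
exists ((pos c, z) :: l); first by rewrite /legs_length big_cons /= addrC;
  congr (_ + _).
move=> y y0; have [odl le1 eq0] := lP y y0; split=> /=.
- by rewrite oddD odl !leNgt; case: (y < z); case: (y < pos c).
- rewrite count_positions /= => h; have := le1 (leq_trans (leq_addl _ _) h).
  rewrite count_positions; apply: leq_trans; rewrite leq_add2r leq_mul2r.
  case: (ltP y (pos c)) odl => // ypc odl; last by rewrite leq_b1 orbT.
  (* A robot to the right of [y] has already crossed it, so with at most one crossing in all this
     walk stays on the right. *)
  have : (0 < crossings l y)%N by rewrite lt0n; apply: contraTneq isT => l0;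
    rewrite l0 in odl.
  by move: h; rewrite leNgt ypc /=; case: (z <= y) => //=; lia.
- move=> /eqP; rewrite addn_eq0 => /andP[h /eqP l0] x; rewrite mem_cat => xc yx.
  apply: eq0 => //; move: xc; rewrite mem_cat => /orP[|->];
    last by rewrite orbT.
  rewrite mem_nseq /= => /andP[k0 /eqP xz]; move: odl;
    rewrite l0 => /esym/negbT; rewrite -leNgt => pcy.
  by move: h; rewrite /= pcy -xz leNgt yx.
Qed.

Lemma complete_crossings (R : realType) (r : R) (I : instance R)
    (q : seq (action R)) :
  0 < r -> admissible r I -> complete r I (offline_run I q) ->
  exists2 l, legs_length l = offline_length I q &
  forall y, 0 <= y < barrier I - r ->
    (0 < crossings l y)%N /\ (deficient r I y -> (1 < crossings l y)%N).
Proof.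
move=> r0 [[L0 srt sin Ln] unc] cq.
have [l lt lP] := offline_crossings I q; exists l => // y /andP[y0 yT].
have [odl le1 eq0] := lP y y0; split.
  rewrite lt0n; apply/eqP => l0.
  have [|x xc /andP[xr xr']] := cq (barrier I); first by rewrite lexx ltW.
  apply: unc; exists x; last by apply/andP.
  by apply: eq0 => //; lra.
rewrite /deficient => dy; rewrite ltnNge; apply/negP => /le1 cle.
(* The point [z] below exceeds [y - r] but is out of reach of the sensors beyond [y], all at [v] or
   further. The cap [barrier I + r] on [v] keeps [z] within the barrier. *)
have [v /andP[yv vL] vP] :=
  @next_above R y (barrier I + r) (positions (offline_run I q)) ltac:(lra).
pose z := (y + v) / 2 - r.
have : z + r <=
    spot r (size [seq x <- positions (offline_run I q) | (x <= y)%R]).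
  apply: covered_le_size => // u /andP[u0 uz].
  have [|x xc xu] := cq u; first by rewrite /z in uz; lra.
  exists x => //; rewrite mem_filter xc andbT leNgt; apply/negP => yx.
  by have := vP x xc yx; move: xu => /andP[]; rewrite /z in uz; lra.
rewrite size_filter => zr.
have : spot r (count (fun x => x <= y)%R (positions (offline_run I q))) <=
  spot r (count (fun x => x <= y)%R (sensors I)) by rewrite ler_spot.
by rewrite /z in zr; lra.
Qed.

(** * The online algorithm *)

Lemma horizon_le (R : realType) (I : instance R) (c : config R) (x : R) :
  x \in ground c -> frontier c < x -> horizon I c <= x.
Proof.
rewrite /horizon; elim: (ground c) => // u s IH; rewrite inE big_cons.
by case: ifP => [_|Fu] /predU1P[->|xs] Fx;
  rewrite ?ge_min ?lexx ?(IH xs Fx) ?orbT //; rewrite Fx in Fu.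
Qed.

Lemma horizonP (R : realType) (I : instance R) (c : config R) :
  horizon I c = barrier I \/
  exists2 x, x \in ground c & frontier c < x /\ horizon I c = x.
Proof.
rewrite /horizon; elim: (ground c) => [|u s IH]; first by left; rewrite big_nil.
rewrite big_cons; case: ifP => [Fu|_]; last first.
  by case: IH => [->|[x xs Hx]]; [left|right; exists x; rewrite // inE xs orbT].
set m := \big[_/_]_(_ <- s | _) _ in IH *.
have [um|mu] := leP u m; first by right; exists u; rewrite // mem_head.
by case: IH => [->|[x xs Hx]]; [left|right; exists x; rewrite // inE xs orbT].
Qed.

Lemma horizon_gt (R : realType) (I : instance R) (c : config R) :
  frontier c < barrier I -> frontier c < horizon I c.
Proof. by case: (horizonP I c) => [->|[x _ [Fx ->]]]. Qed.

(* The sensors lying behind the robot are exactly those it has dropped, at the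
   first spots. At the next spot one sensor is left. Off a spot all sensors are
   collected; beyond it, the robot is short of sensors and goes on to the right
   until it owns enough of them to fill all the spots up to its position. *)
Definition sweep_rule (R : realType) (r : R) (c : config R) : action R :=
  let b := count (fun x => x < pos c) (ground c) in
  let q := count_mem (pos c) (ground c) in
  let a := spot r b in
  if pos c == a then
    if (1 < q)%N then PickUp
    else if (q == 0)%N && (0 < carried c)%N then Drop
    else Move (pos c + 2 * r)
  else if (0 < q)%N then PickUp
  else if (pos c < a) || (pos c < spot r (b + carried c)) then Move a
  else Move (pos c + 2 * r).

Definition sweep (R : realType) (r : R) : algorithm R :=
  fun h => if h is (c, _) :: _ then sweep_rule r c else PickUp.

Definition sweep_next (R : realType) (r : R) (I : instance R) (c : config R) :=
  perform (horizon I c) c (sweep_rule r (observe I c).1).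

(** The history always begins with the current observation, so the default action of [sweep] on an
    empty history never occurs. *)
Lemma online_run_sweep (R : realType) (r : R) (I : instance R) (k : nat) :
  (online_run (sweep r) I k.+1).1 = sweep_next r I (online_run (sweep r) I k).1.
Proof.
have H : exists h, (online_run (sweep r) I k).2 =
    observe I (online_run (sweep r) I k).1 :: h.
  case: k => [|k] /=; first by exists [::].
  by case: (online_run _ I k) => c h; exists h.
by case: H => h /=; case: (online_run _ I k) => c h' /= ->.
Qed.

(** Each point is allowed one crossing, or three if deficient. Between the robot and its frontier
    all points are deficient, with one crossing to spare for the way back to the right. *)
Definition route (R : realType) (r : R) (I : instance R) (p F : R)
    (l : seq (R * R)) : Prop :=
  [/\ forall y, (y < 0) || (F <= y) -> crossings l y = 0,
      forall y, p <= y < F -> deficient r I y /\ (crossings l y <= 2)%N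
    & forall y, (crossings l y <= 1 + deficient r I y * 2)%N].

(** Points of [[p, F)] are deficient and take at most their third crossing; points from [F] on take
    their first. *)
Lemma route_right (R : realType) (r : R) (I : instance R) (p F z : R)
    (l : seq (R * R)) :
  0 <= p <= F -> p <= z -> route r I p F l ->
  route r I z (Num.max F z) ((p, z) :: l).
Proof.
move=> /andP[p0 pF] pz [out gap all]; split=> y /=.
- rewrite ge_max => /orP[y0|/andP[Fy zy]].
    by rewrite out ?y0 // !leNgt (lt_le_trans y0 p0) (lt_le_trans y0 (le_trans
      p0 pz)).
  by rewrite out ?Fy ?orbT // zy (le_trans pz zy).
- rewrite lt_max => /andP[zy /orP[yF|]]; last by rewrite ltNge zy.
  have [|dy cy] := gap y; first by rewrite yF (le_trans pz zy).
  by split=> //; rewrite zy (le_trans pz zy).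
have [yp|py] := ltP y p; first by rewrite leNgt (lt_le_trans yp pz); exact: all.
have [zy|yz] := leP z y; first exact: all.
have [yF|Fy] := ltP y F; first by have [|-> /=] := gap y; rewrite ?py ?yF //;
  lia.
by rewrite out ?Fy ?orbT.
Qed.

(* The first b spots are filled, q sensors lie at the position of the robot, and
   w steps of length 2r suffice to reach L - r. *)
Record sweeping (R : realType) (r : R) (I : instance R) (c : config R)
    (b q w : nat) (l : seq (R * R)) : Prop := Sweeping {
  swp_ground : perm_eq (ground c)
    (map (spot r) (iota 0 b) ++ nseq q (pos c) ++
     [seq x <- sensors I | frontier c < x]);
  swp_count : (b + q + carried c)%N =
    count (fun x => x <= frontier c)%R (sensors I);
  swp_pos : 0 <= pos c <= frontier c;
  swp_spot : spot r b - 2 * r < pos c;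
  swp_length : legs_length l = travelled c;
  swp_route : route r I (pos c) (frontier c) l;
  swp_refill : pos c < frontier c -> ~~ deficient r I (frontier c);
  swp_short : spot r b < pos c -> pos c = frontier c /\
    forall y,
      spot r b <= y < pos c -> deficient r I y /\ (crossings l y <= 1)%N;
  swp_dist : barrier I - r - frontier c <= 2 * r * w%:R
}.

(* An action that brings no progress in b, w or the number of discovered sensors
   decreases the last term, which is at most n + 2. *)
Definition potential (R : realType) (r : R) (I : instance R) (c : config R)
    (b q w : nat) : nat :=
  let n := size (sensors I) in
  ((n + 3) *
     ((n - b) + (n - count (fun x => x <= frontier c)%R (sensors I)) + w)
   + if pos c == spot r b then (if q is 0 then 1 else q.-1) else q.+2)%N.

(** Advancing the frontier from [F] to [z], with nothing undiscovered before [z], discovers exactly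
    the [q] sensors located at [z]. *)
Lemma undiscovered_split (R : realType) (s : seq R) (F z : R) :
  {in s, forall x, F < x -> z <= x} ->
  exists2 q, (q + count (fun x => x <= F)%R s =
              count (fun x => x <= Num.max F z)%R s)%N &
  [/\ perm_eq [seq x <- s | F < x]
        (nseq q z ++ [seq x <- s | Num.max F z < x]),
      z <= F -> q = 0
    & F < z -> z \in s -> (0 < q)%N].
Proof.
move=> sFz; have [zF|Fz] := leP z F.
  by exists 0 => //; split=> //; rewrite ltNge zF.
exists (count_mem z s).
  elim: s sFz => //= x s IH sFz; rewrite -IH; last first.
    by move=> y ys; apply: sFz; rewrite inE ys orbT.
  have := sFz x (mem_head _ _); case: (ltgtP x z) => [xz|xz|->] /=.
  - by case: (ltP F x) => [_ /(_ isT)//|_ _]; lia.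
  - by move=> _; rewrite (lt_geF (lt_trans Fz xz)); lia.
  - by move=> _; rewrite (lt_geF Fz); lia.
split=> //; [|by rewrite -has_count has_pred1].
apply/permP => P; rewrite count_cat count_nseq !count_filter.
elim: s sFz => [|x s IH] sFz /=; first by rewrite muln0.
rewrite IH; last by move=> y ys; apply: sFz; rewrite inE ys orbT.
have := sFz x (mem_head _ _); case: (ltgtP x z) => [xz|xz|->] /=.
- by case: (ltP F x) => [_ /(_ isT)//|_ _]; rewrite andbF; lia.
- by move=> _; rewrite (lt_trans Fz xz) !andbT; case: (P z); case: (P x); lia.
- by move=> _; rewrite Fz andbT andbF; case: (P z); lia.
Qed.

Lemma mem_spots (R : realType) (r : R) (b : nat) (x : R) :
  0 < r -> x \in map (spot r) (iota 0 b) -> x <= spot r b - 2 * r.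
Proof.
move=> r0 /mapP[i]; rewrite mem_iota add0n => /andP[_ ib] ->.
case: b ib => // b ib; have := ler_spot i b r0.
by rewrite -ltnS ib spotS; lra.
Qed.

(** Ground without sensors between [F] and [y] leaves the count known at [F] unchanged. *)
Lemma deficient_eq (R : realType) (r : R) (I : instance R) (F y : R) :
  F <= y -> {in sensors I, forall x, F < x -> y < x} ->
  deficient r I y =
  (spot r (count (fun x => x <= F)%R (sensors I)) <= y).
Proof.
move=> Fy sFy; rewrite /deficient; congr (spot _ _ <= _).
apply: eq_in_count => x xs /=; have [xF|Fx] := leP x F.
  by rewrite (le_trans xF).
by rewrite leNgt sFy.
Qed.

Lemma admissible_sensor_lt (R : realType) (r : R) (I : instance R) (x : R) :
  admissible r I -> x \in sensors I -> x < barrier I - r.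
Proof.
move=> [[L0 _ sL _] unc] xs; rewrite ltNge; apply/negP => Tx; apply: unc.
exists x => //; have /andP[_ xL] := sL x xs.
by apply/andP; split; lra.
Qed.

Lemma enough_sensors (R : realType) (r : R) (I : instance R) :
  admissible r I -> barrier I + r <= spot r (size (sensors I)).
Proof. by move=> [[_ _ _ Ln] _]; rewrite spotE; lra. Qed.

Lemma undiscovered_ge (R : realType) (I : instance R) (c : config R)
    (s : seq R) (x : R) :
  perm_eq (ground c) (s ++ [seq x <- sensors I | frontier c < x]) ->
  x \in sensors I -> frontier c < x -> horizon I c <= x.
Proof.
move=> gc xs Fx; apply: horizon_le => //.
by rewrite (perm_mem gc) mem_cat mem_filter Fx xs orbT.
Qed.

(** The hypotheses resemble [sweeping] with [q = 0]: [b] may just have been raised because the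
    sensor at the robot now counts as filling its spot. The conclusions concern a move reaching
    [L - r], the invariant after the move, and what may stop a move before [L - r]. *)
Lemma sweeping_advance (R : realType) (r : R) (I : instance R)
    (c : config R) (b : nat) (l : seq (R * R)) (z : R) :
  0 < r -> admissible r I ->
  perm_eq (ground c) (map (spot r) (iota 0 b) ++
     [seq x <- sensors I | frontier c < x]) ->
  (b + carried c)%N = count (fun x => x <= frontier c)%R (sensors I) ->
  0 <= pos c <= frontier c -> spot r b - 2 * r < z ->
  legs_length l = travelled c -> route r I (pos c) (frontier c) l ->
  (pos c < frontier c -> ~~ deficient r I (frontier c)) ->
  (spot r b < z -> [/\ pos c = frontier c,
     spot r (b + carried c) <= frontier c &
     forall y, spot r b <= y < pos c ->
       deficient r I y /\ (crossings l y <= 1)%N]) ->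
  pos c < z <= horizon I c ->
  [/\ frontier c < barrier I - r -> barrier I - r <= z ->
        [/\ pos c <= barrier I - r, complete r I (walk c (barrier I - r)) &
          exists2 l', legs_length l' = travelled (walk c (barrier I - r)) &
            route r I (barrier I - r) (barrier I - r) l'],
      forall w', barrier I - r - Num.max (frontier c) z <= 2 * r * w'%:R ->
      exists q,
        [/\ sweeping r I (walk c z) b q w' ((pos c, z) :: l),
            (q + count (fun x => x <= frontier c)%R (sensors I))%N =
            count (fun x => x <= Num.max (frontier c) z)%R (sensors I),
            z <= frontier c -> q = 0
          & frontier c < z -> z \in sensors I -> (0 < q)%N] &
      z < barrier I - r ->
      z < horizon I c \/ (frontier c < z /\ z \in sensors I)].
Proof.
move=> r0 admI gc cnt pc bz ll rt refill short /andP[pz zh].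
have slt := admissible_sensor_lt admI; have enough := enough_sensors admI.
have sz x : x \in sensors I -> frontier c < x -> z <= x.
  by move=> xs Fx; apply: le_trans zh (undiscovered_ge gc xs Fx).
split.
- move=> FT Tz.
  (* Undiscovered sensors would lie at [z] or further, hence not below [L - r], where all sensors
     start: every sensor has been found. *)
  have cn : (b + carried c)%N = size (sensors I).
    rewrite cnt; apply/eqP; rewrite -all_count; apply/allP => x xs.
    rewrite leNgt; apply/negP => Fx.
    by have := slt _ xs; rewrite ltNge (le_trans Tz (sz x xs Fx)).
  have pT : pos c <= (barrier I - r) by move: pc => /andP[_ pF]; lra.
  (* Going beyond [spot r b] presupposes a shortage at the frontier, impossible once all [n] sensors
     are owned. *)
  have Tb : (barrier I - r) <= spot r b.
    have [bz'|zb] := ltP (spot r b) z; last exact: le_trans zb.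
    have [_ + _] := short bz'; rewrite cn => nF; have nL := enough; lra.
  have sb : {in gtn b, forall i,
    spot r i \in positions (walk c (barrier I - r))}.
    move=> i ib; rewrite mem_cat /= (perm_mem gc) mem_cat.
    by rewrite map_f ?mem_iota // !orbT.
  split=> //.
    (* With nothing in hand, all [n] sensors lie at spots and reach [L]; otherwise a carried sensor,
       located at the robot, covers the end from [L - r]. *)
    move=> y /andP[y0 yL]; have [k0|k0] := posnP (carried c).
      apply: (spots_cover r0 sb) => //.
        rewrite lt0n; apply/eqP => b0; move: enough.
        rewrite -cn k0 b0 spot0; case: admI => -[L0 _ _ _] _; lra.
      by have := enough; rewrite -cn k0 addn0; lra.
    apply: (spots_end_cover r0 sb (L := barrier I)) => //; last by rewrite y0.
    by rewrite mem_cat mem_nseq /= k0 eqxx.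
  have := route_right pc pT rt; rewrite max_r ?(ltW FT) // => rt'.
  by exists ((pos c, (barrier I - r)) :: l);
    rewrite // /legs_length big_cons /= -/(legs_length l) ll addrC.
- move=> w' Tw; have [q qc [Uq q0 q1]] := undiscovered_split sz.
  exists q; split=> //; split=> //=.
  + by apply: perm_trans gc _; rewrite perm_cat2l.
  + by rewrite -qc -cnt addnCA addnA.
  + by rewrite le_max lexx orbT andbT; move: pc => /andP[]; lra.
  + by rewrite /legs_length big_cons /= -/(legs_length l) ll addrC.
  + exact: route_right (ltW pz) rt.
  + rewrite lt_max ltxx orbF => zF; rewrite max_l ?ltW // refill //.
    exact: lt_trans zF.
  + move=> bz'; have [pF bF yD] := short bz'; rewrite -pF max_r ?ltW //;
      split=> // y /andP[by_ yz].
    have [yp|py] := ltP y (pos c).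
      have [|dy cy] := yD y; first by rewrite by_.
      by rewrite leNgt (lt_trans yp pz).
    (* Fresh ground is deficient: the sensors owned are too few at the frontier already, and none is
       met up to [y]. *)
    have -> : deficient r I y.
      rewrite (@deficient_eq _ _ _ (frontier c)) -?pF //.
        by rewrite -pF in bF; rewrite pF -cnt (le_trans bF) // -pF.
      by move=> x xs px; apply: lt_le_trans yz (sz x xs _); rewrite -pF.
    by case: rt => out _ _; rewrite out -?pF ?py ?orbT //; case: (z <= y).
- move=> zT; have [zh'|hz] := ltP z (horizon I c); first by left.
  right; have zE : horizon I c = z by apply/eqP; rewrite eq_le hz zh.
  case: (horizonP I c) => [|[x xg [Fx xE]]].
    by rewrite zE => zL; move: zT; rewrite zL; lra.
  rewrite -zE xE; split=> //; move: xg; rewrite (perm_mem gc) mem_cat.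
  case/orP => [/(mem_spots r0)|]; first by rewrite -xE zE; lra.
  by rewrite mem_filter => /andP[].
Qed.

(** The sensors strictly behind the robot are those at the [b] filled spots, so the counts made by
    the rule on what it observes are the [b] and [q] of the invariant. *)
Lemma sweep_ruleE (R : realType) (r : R) (I : instance R) (c : config R)
    (b q w : nat) (l : seq (R * R)) :
  0 < r -> sweeping r I c b q w l ->
  sweep_rule r (observe I c).1 =
  if pos c == spot r b then
    if (1 < q)%N then PickUp
    else if (q == 0)%N && (0 < carried c)%N then Drop
    else Move (pos c + 2 * r)
  else if (0 < q)%N then PickUp
  else if (pos c < spot r b) || (pos c < spot r (b + carried c))
  then Move (spot r b)
  else Move (pos c + 2 * r).
Proof.
move=> r0 [gc _ /andP[_ pF] bp _ _ _ _ _].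
have spot_lt x : x \in map (spot r) (iota 0 b) -> x < pos c.
  by move=> /(mem_spots r0) /le_lt_trans; apply.
have cb : count (fun x => x < pos c)%R [seq x <- ground c | x <= frontier c]
    = b.
  rewrite count_filter (permP gc) !count_cat count_nseq /= ltxx addnA.
  rewrite (@eq_in_count _ _ predT) ?count_predT ?size_map ?size_iota;
    last first.
    by move=> x /spot_lt xp /=; rewrite xp (le_trans (ltW xp)).
  rewrite count_filter (@eq_in_count _ _ pred0) ?count_pred0 ?addn0 //.
  move=> x _ /=; case: (ltP x (pos c)) => //= xp.
  by rewrite (le_trans (ltW xp) pF) /= ltNge (le_trans (ltW xp) pF).
have cq : count_mem (pos c) [seq x <- ground c | x <= frontier c] = q.
  rewrite count_filter (permP gc) !count_cat count_nseq /= eqxx pF mul1n.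
  rewrite (@eq_in_count _ _ pred0) ?count_pred0 ?add0n; last first.
    by move=> x /spot_lt xp /=; rewrite (lt_eqF xp).
  rewrite count_filter (@eq_in_count _ _ pred0) ?count_pred0 ?addn0 //.
  by move=> x _ /=; case: eqP => //= ->; rewrite pF /= ltNge pF.
by rewrite /sweep_rule /observe /= cb cq.
Qed.

Lemma sweeping_pickup (R : realType) (r : R) (I : instance R) (c : config R)
    (b q w : nat) (l : seq (R * R)) (lim : R) :
  sweeping r I c b q.+1 w l ->
  sweeping r I (perform lim c PickUp) b q w l /\
  pos (perform lim c PickUp) = pos c /\
  frontier (perform lim c PickUp) = frontier c.
Proof.
move=> [gc cnt pc bp ll rt refill short dist].
have pg : pos c \in ground c.
  by rewrite (perm_mem gc) !mem_cat mem_head orbT.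
rewrite /= pg; split=> //; split=> //=; last by rewrite -cnt; lia.
rewrite -(perm_cons (pos c)); apply: perm_trans (_ : perm_eq (ground c) _).
  by rewrite perm_sym perm_to_rem.
by apply: perm_trans gc _; rewrite (perm_catCA _ [:: pos c]).
Qed.

Lemma sweeping_drop (R : realType) (r : R) (I : instance R) (c : config R)
    (b q w : nat) (l : seq (R * R)) (lim : R) :
  (0 < carried c)%N -> sweeping r I c b q w l ->
  sweeping r I (perform lim c Drop) b q.+1 w l /\
  pos (perform lim c Drop) = pos c /\
  frontier (perform lim c Drop) = frontier c.
Proof.
case: c => p F t [//|k] g _ [gc cnt pc bp ll rt refill short dist].
rewrite /= in gc cnt *; split=> //; split=> //=; last by rewrite -cnt; lia.
by rewrite perm_sym (perm_catCA _ [:: p]) perm_cons perm_sym.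
Qed.

(** The stretch back to [spot r b] consists of deficient points crossed at most once, so this is at
    most their second crossing. Owning enough sensors makes the frontier itself non-deficient, as
    [swp_refill] demands. *)
Lemma sweeping_return (R : realType) (r : R) (I : instance R) (c : config R)
    (b w : nat) (l : seq (R * R)) :
  0 < r -> sweeping r I c b 0 w l -> spot r b < pos c ->
  pos c < spot r (b + carried c) ->
  sweeping r I (walk c (spot r b)) b 0 w ((pos c, spot r b) :: l).
Proof.
move=> r0 [gc cnt pc bp ll rt refill short dist] bz enough.
have [pF yD] := short bz; have b0 : 0 < spot r b by rewrite mulr_gt0.
have Fb : Num.max (frontier c) (spot r b) = frontier c.
  by rewrite max_l // -pF ltW.
split=> //=; rewrite ?Fb ?ltxx //.
- by rewrite ltW //= -pF ltW.
- lra.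
- by rewrite /legs_length big_cons /= -/(legs_length l) ll addrC.
- case: rt => out gap all; split=> y /=.
  + case/orP => [y0|Fy].
      by rewrite out ?y0 // !leNgt (lt_trans y0 b0)
        (lt_trans y0 (lt_trans b0 bz)).
    by rewrite out ?Fy ?orbT // pF Fy (le_trans (ltW bz)) // pF.
  + rewrite -pF => /andP[by_ yp]; have [|dy cy] := yD y;
      first by rewrite by_ yp.
    by rewrite by_ leNgt yp.
  + have [yb|by_] := ltP y (spot r b).
      by rewrite leNgt (lt_trans yb bz); exact: all.
    have [yp|py] := ltP y (pos c); last exact: all.
    by have [|-> cy] := yD y; rewrite ?by_ ?yp //= (leq_add2l 1) (leq_trans cy).
- by rewrite /deficient -ltNge -cnt addn0 -pF.
Qed.

(** The last term of [potential] stays below the weight [n + 3], so it cannot offset progress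
    elsewhere; [b' <= m'] ensures that the truncated [n - b] really decreases. *)
Lemma potential_lt (R : realType) (r : R) (I : instance R) (c c' : config R)
    (b b' q q' w w' : nat) :
  let n := size (sensors I) in
  let m := count (fun x => x <= frontier c)%R (sensors I) in
  let m' := count (fun x => x <= frontier c')%R (sensors I) in
  (b' <= m')%N -> (q' <= n)%N -> (b <= b')%N -> (m <= m')%N -> (w' <= w)%N ->
  [\/ (b < b')%N, (m < m')%N, (w' < w)%N |
    ((if pos c' == spot r b' then (if q' is 0 then 1 else q'.-1) else q'.+2) <
     (if pos c == spot r b then (if q is 0 then 1 else q.-1) else q.+2))%N] ->
  (potential r I c' b' q' w' < potential r I c b q w)%N.
Proof.
move=> n m m' bm qn bb mm ww; rewrite /potential -/n -/m -/m'.
have m'n : (m' <= n)%N by apply: count_size.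
set loc' := (if pos c' == _ then _ else _);
  set loc := (if pos c == _ then _ else _).
have loc'n : (loc' <= n + 2)%N by rewrite /loc'; case: ifP => _;
  [case: (q') qn|]; lia.
set A' := (_ + w')%N; set A := (_ + w)%N => H.
have AA : (A' <= A)%N by rewrite /A /A'; lia.
have [] : (A' < A)%N \/ (loc' < loc)%N.
  by case: H => H; [left|left|left|right] => //; rewrite /A /A'; lia.
- by move=> lt; have := leq_mul (leqnn (n + 3)) lt; rewrite mulnS; lia.
- by move=> lt; have := leq_mul (leqnn (n + 3)) AA; lia.
Qed.

(** Coverage is attained at [L - r], possibly in the middle of the move from [c] to [c'], so the
    route is that of the shortened walk. *)
Definition sweep_done (R : realType) (r : R) (I : instance R)
    (c c' : config R) : Prop :=
  [/\ pos c <= barrier I - r <= pos c', complete r I (walk c (barrier I - r)) &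
    exists2 l, legs_length l = travelled (walk c (barrier I - r)) &
      route r I (barrier I - r) (barrier I - r) l].

(** Common to all moves to the right. Progress is a newly filled spot, a full step of the frontier,
    or arrival at the next spot; a move cut short before [L - r] meets a new sensor, which is
    progress too. *)
Lemma sweep_right (R : realType) (r : R) (I : instance R) (c : config R)
    (b q w b' : nat) (l : seq (R * R)) (y : R) :
  0 < r -> admissible r I -> frontier c < barrier I - r ->
  sweeping r I c b q w l -> (b <= b')%N ->
  perm_eq (ground c) (map (spot r) (iota 0 b') ++
     [seq x <- sensors I | frontier c < x]) ->
  (b' + carried c)%N = count (fun x => x <= frontier c)%R (sensors I) ->
  pos c < y -> spot r b' - 2 * r <= pos c ->
  (spot r b' < y -> [/\ pos c = frontier c,
     spot r (b' + carried c) <= frontier c &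
     forall y, spot r b' <= y < pos c ->
       deficient r I y /\ (crossings l y <= 1)%N]) ->
  [\/ (b < b')%N, frontier c + 2 * r <= y |
      [/\ q = 0, pos c < spot r b & y = spot r b']] ->
  let c' := perform (horizon I c) c (Move y) in
  sweep_done r I c c' \/
  frontier c' < barrier I - r /\
  exists b' q' w' l', sweeping r I c' b' q' w' l' /\
    (potential r I c' b' q' w' < potential r I c b q w)%N.
Proof.
move=> r0 admI FT sw bb' gc cnt py bp short prog c'.
have [_ _ /andP[p0 pF] _ ll rt refill _ dist] := sw.
have FL : frontier c < barrier I by lra.
pose z := Num.min y (horizon I c).
have pz : pos c < z by rewrite lt_min py (le_lt_trans pF (horizon_gt FL)).
have zy : z <= y by rewrite ge_min lexx.
have zh : z <= horizon I c by rewrite ge_min lexx orbT.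
have -> : c' = walk c z by rewrite /c' /= max_r // ltW // (le_lt_trans p0).
have [|||||||done_ next_ sens] :=
  @sweeping_advance R r I c b' l z r0 admI gc cnt.
- by rewrite p0.
- exact: le_lt_trans pz.
- by [].
- by [].
- by [].
- by move=> bz; apply: short; apply: lt_le_trans zy.
- by rewrite pz.
have [Tz|zT] := leP (barrier I - r) z.
  by left; have [pT cT lT] := done_ FT Tz; split=> //; rewrite pT.
right; split; first by rewrite /= gt_max FT.
pose w' := if frontier c + 2 * r <= z then w.-1 else w.
have w0 : (0 < w)%N.
  by rewrite lt0n; apply/eqP => w0; move: dist; rewrite w0 mulr0; lra.
have w'w : (w' <= w)%N by rewrite /w'; case: ifP => // _; apply: leq_pred.
have [|q' [sw' cq q0 q1]] := next_ w'.
  rewrite /w'; case: (leP (frontier c + 2 * r) z) => Fz.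
    rewrite max_r; last lra.
    have wE : w%:R = w.-1%:R + 1 :> R by rewrite natr1 prednK.
    by move: dist; rewrite wE mulrDr; lra.
  by apply: le_trans dist; rewrite lerB // le_max lexx.
exists b', q', w', ((pos c, z) :: l); split=> //.
have mn : (count (fun x => x <= frontier (walk c z))%R (sensors I)
    <= size (sensors I))%N.
  exact: count_size.
apply: potential_lt => //=.
- by have := swp_count sw' => /= <-; rewrite -addnA leq_addr.
- by apply: leq_trans mn; rewrite /= -cq leq_addr.
- by rewrite -cq leq_addl.
have [q'0|q'0] := posnP q'; last by apply: Or42;
  rewrite -cq -[ltnLHS]add0n ltn_add2r.
(* With no new sensor at [z], the move was not cut off. *)
have zyE : z = y.
  have [zh'|[Fz zs]] := sens zT; last by have := q1 Fz zs; rewrite q'0.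
  by move: zh'; rewrite /z; case: (ltP y (horizon I c)) => [//|_]; rewrite ltxx.
case: prog => [bb|Fy|[-> pb yE]].
- exact: Or41.
- by apply: Or43; rewrite /w' zyE Fy prednK.
- by apply: Or44; rewrite q'0 (lt_eqF pb) zyE yE eqxx.
Qed.

Lemma sweep_step (R : realType) (r : R) (I : instance R) (c : config R)
    (b q w : nat) (l : seq (R * R)) :
  0 < r -> admissible r I -> frontier c < barrier I - r ->
  sweeping r I c b q w l ->
  let c' := sweep_next r I c in
  sweep_done r I c c' \/
  frontier c' < barrier I - r /\
  exists b' q' w' l', sweeping r I c' b' q' w' l' /\
    (potential r I c' b' q' w' < potential r I c b q w)%N.
Proof.
move=> r0 admI FT sw /=.
have [gc cnt pc bp ll rt refill short dist] := sw.
have /andP[p0 pF] := pc.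
have FL : frontier c < barrier I by lra.
have mn : (count (fun x => x <= frontier c)%R (sensors I)
    <= size (sensors I))%N.
  exact: count_size.
have pickup q0 : q = q0.+1 -> (1 < q)%N || (pos c != spot r b) ->
  let c' := perform (horizon I c) c PickUp in
  frontier c' < barrier I - r /\
  exists b' q' w' l', sweeping r I c' b' q' w' l' /\
    (potential r I c' b' q' w' < potential r I c b q w)%N.
  move=> qE hq; rewrite qE in sw; have [sw' [pE FE]] :=
    sweeping_pickup (horizon I c) sw.
  split; first by rewrite FE.
  exists b, q0, w, l; split=> //; apply: potential_lt; rewrite ?FE ?pE //.
  - by rewrite -cnt -addnA leq_addr.
  - by apply: leq_trans mn;
      rewrite -cnt qE -addnA addnCA addSn leqW // leq_addr.
  - by apply: Or44; move: hq; rewrite qE; case: eqP => //= _; case: (q0).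
rewrite /sweep_next (sweep_ruleE r0 sw).
case: eqP => [pb|/eqP pb].
  case: q => [|[|q]] in sw gc cnt pickup *; last 1 first.
  - by right; apply: (pickup q.+1).
  - have [k0|k0] := posnP (carried c); last first.
      right; have [sw' [pE FE]] := sweeping_drop (horizon I c) k0 sw.
      split; first by rewrite FE.
      exists b, 1, w, l; split=> //; apply: potential_lt; rewrite ?FE ?pE //.
      + by rewrite -cnt -addnA leq_addr.
      + by apply: leq_trans mn; rewrite -cnt (leq_trans k0) // leq_addl.
      + by apply: Or44; rewrite pb eqxx.
    (* Behind the frontier the robot would own enough sensors for the spots up to there; with empty
       hands at an empty spot it does not. *)
    have pFE : pos c = frontier c.
      apply/eqP; rewrite eq_le pF leNgt; apply/negP => /refill.
      by rewrite /deficient -cnt k0 !addn0 -pb pF.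
    rewrite addn0 in cnt; apply: (@sweep_right R r I c b 0 w b l) => //.
    + lra.
    + by rewrite pb; lra.
    + by rewrite k0 addn0 -pb pFE => _; split=> // y /andP[Fy];
        rewrite ltNge Fy.
    + by apply: Or32; rewrite pFE.
  - apply: (@sweep_right R r I c b 1 w b.+1 l) => //; rewrite ?spotS -?pb.
    + by apply: perm_trans gc _;
        rewrite -(addn1 b) iotaD map_cat /= add0n -pb -catA.
    + by rewrite -cnt addn1.
    + lra.
    + lra.
    + by rewrite ltxx.
    + exact: Or31.
case: q => [|q] in sw gc cnt pickup *; last by right; apply: (pickup q);
  rewrite // pb orbT.
rewrite addn0 in cnt; have [pb'|bp'] := ltP (pos c) (spot r b) => /=.
  apply: (@sweep_right R r I c b 0 w b l) => //; first exact: ltW.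
    by rewrite ltxx.
  exact: Or33.
have {}bp' : spot r b < pos c by rewrite lt_neqAle eq_sym pb.
have [pFE yD] := short bp'.
case: ltP => hk.
  right; rewrite [perform _ _ _]/=.
  have b0 : 0 < spot r b by rewrite mulr_gt0.
  have -> : Num.max 0 (Num.min (spot r b) (horizon I c)) = spot r b.
    rewrite min_l ?max_r ?(ltW b0) //.
    by rewrite (le_trans (ltW bp')) // pFE ltW // horizon_gt.
  have FE : frontier (walk c (spot r b)) = frontier c.
    by rewrite /= max_l // -pFE ltW.
  split; first by rewrite FE.
  exists b, 0, w, ((pos c, spot r b) :: l); split; first exact: sweeping_return.
  apply: potential_lt; rewrite ?FE //=; first by rewrite -cnt leq_addr.
  by apply: Or44; rewrite eqxx (negbTE pb).
apply: (@sweep_right R r I c b 0 w b l) => //.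
- lra.
- exact: ltW.
- by rewrite -pFE.
- by apply: Or32; rewrite pFE.
Qed.

Lemma sweep_terminates (R : realType) (r : R) (I : instance R) :
  0 < r -> admissible r I ->
  exists k, let c := (online_run (sweep r) I k).1 in
    sweep_done r I c (online_run (sweep r) I k.+1).1.
Proof.
move=> r0 admI; have [[L0 _ sI Ln] unc] := admI.
have s0 x : x \in sensors I -> 0 <= x by move=> /sI/andP[].
have LT : 0 < barrier I - r.
  have : (0 < size (sensors I))%N.
    by rewrite lt0n; apply: contraTneq Ln => ->; rewrite mulr0 -ltNge.
  case E: (sensors I) => [//|x s] _;
    have xs : x \in sensors I by rewrite E mem_head.
  exact: le_lt_trans (s0 x xs) (admissible_sensor_lt admI xs).
suff H m k b q w l : let c := (online_run (sweep r) I k).1 in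
    (potential r I c b q w < m)%N -> frontier c < barrier I - r ->
    sweeping r I c b q w l ->
    exists k, let c := (online_run (sweep r) I k).1 in
    sweep_done r I c (online_run (sweep r) I k.+1).1.
  pose w := Num.bound ((barrier I - r) / (2 * r)).
  (* Sensors at 0 are known from the start: the fictitious advance from -1 to 0 counts them. *)
  have [|q cq [Uq _ _]] := @undiscovered_split R (sensors I) (-1) 0.
    by move=> x /s0.
  have max10 : Num.max (-1) 0 = 0 :> R by apply: max_r; lra.
  rewrite max10 in cq Uq.
  apply: (H (potential r I (start I) 0 q w).+1 0 0%N q w [::]) => //.
  split=> //=.
  - apply: perm_trans Uq; rewrite (@eq_in_filter _ _ predT) ?filter_predT //.
    by move=> x /s0 x0 /=; apply/idP; lra.
  - rewrite -cq (@eq_in_count _ _ pred0) ?count_pred0 //.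
    by move=> x /s0 x0 /=; apply/negbTE; rewrite -ltNge; lra.
  - by rewrite lexx.
  - by rewrite spot0; lra.
  - by rewrite /legs_length big_nil.
  - split=> // y; by case: ltP.
  - by rewrite ltxx.
  - by rewrite spot0 => /lt_trans/(_ r0); rewrite ltxx.
  - rewrite subr0 mulrC -ler_pdivrMr ?mulr_gt0 // ltW // /w.
    by apply: archi_boundP; rewrite divr_ge0 // ltW // mulr_gt0.
elim: m k b q w l => // m IH k b q w l c lt_m FT sw.
have [done_|[F'T [b' [q' [w' [l' [sw' pot]]]]]]] := sweep_step r0 admI FT sw.
  by exists k; rewrite online_run_sweep.
apply: (IH k.+1 b' q' w' l'); rewrite online_run_sweep //.
exact: leq_trans pot _.
Qed.

(** * Competitive ratio of the sweep *)

Lemma travelled_online_ge0 (R : realType) (A : algorithm R) (I : instance R)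
    (k : nat) :
  0 <= travelled (online_run A I k).1.
Proof.
elim: k => //= k; case: (online_run A I k) => c h /= t0.
by case: (perform_positions (horizon I c) c (A h)) => [[z _ ->]|[_ _ ->]//];
  rewrite addr_ge0.
Qed.

Lemma completion_lengths_lbound (R : realType) (r : R) (A : algorithm R)
    (I : instance R) :
  has_lbound (completion_lengths r A I).
Proof.
exists 0 => t [c [[k [z [_ ->]]] _] <-].
by rewrite addr_ge0 // travelled_online_ge0.
Qed.

Lemma sweep_completion (R : realType) (r : R) (I : instance R) :
  0 < r -> admissible r I ->
  exists2 t, completion_lengths r (sweep r) I t &
  forall q, complete r I (offline_run I q) -> 2 * t <= 3 * offline_length I q.
Proof.
move=> r0 admI; have [k] := sweep_terminates r0 admI.
set c := (online_run _ _ k).1; set c' := (online_run _ _ k.+1).1.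
case=> /andP[pT Tp] cT [l lt [out _ lD]].
exists (travelled (walk c (barrier I - r))).
  exists (walk c (barrier I - r)) => //; split=> //.
  exists k, (barrier I - r); split=> //.
  by rewrite ge_min pT le_max Tp orbT.
move=> q /(complete_crossings r0 admI)[l' <- lP]; rewrite -lt.
apply: (@ler_legs_length _ 2 3) => y.
have [yout|] := boolP ((y < 0) || (barrier I - r <= y)); first by rewrite out.
(* The comparison is [2 * 3 <= 3 * 2] at deficient points and [2 * 1 <= 3 * 1] elsewhere. *)
rewrite negb_or -leNgt -ltNge => /lP[]; have := lD y.
by case: (deficient r I y) => /= h h0 h1; [have {}h1 := h1 isT|]; lia.
Qed.

Lemma sweep_restores (R : realType) (r : R) :
  0 < r -> restores_coverage r (sweep r).
Proof. by move=> r0 I /(sweep_completion r0)[t tI _]; exists t. Qed.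

Lemma sweep_competitive_ratio (R : realType) (r : R) :
  0 < r -> (competitive_ratio r (sweep r) <= (3 / 2)%:E)%E.
Proof.
move=> r0; apply: ge_ereal_sup => _ [I [p [admI [cp _] ->]]].
have [t tI /(_ p cp) tp] := sweep_completion r0 admI.
have on_t : online_length r (sweep r) I <= t.
  exact: ge_inf (completion_lengths_lbound _ _ _) _ tI.
rewrite lee_fin; have [p0|p0] := ltP 0 (offline_length I p).
  by rewrite ler_pdivrMr //; lra.
(* An offline length that is not positive must be 0; the quotient is then 0 by the convention on
   inverses. *)
have t0 : 0 <= t.
  by case: tI => c [[k [z [_ ->]]] _] <-;
    rewrite addr_ge0 // travelled_online_ge0.
have -> : offline_length I p = 0 by lra.
by rewrite invr0 mulr0; lra.
Qed.

(** * Piles of sensors *)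

Definition pile (R : realType) (d : R) (n : nat) (L : R) : instance R :=
  Instance L (nseq n d).

Lemma pile_admissible (R : realType) (r d L : R) (n : nat) :
  0 < r -> 0 < d -> d < L - r -> L <= 2 * r * n%:R ->
  admissible r (pile d n L).
Proof.
move=> r0 d0 dL Ln; split.
  split=> /=; first lra.
  - by elim: n {Ln} => [//|[|n] //= ->]; rewrite lexx.
  - by move=> x; rewrite mem_nseq => /andP[_ /eqP ->]; lra.
  - by rewrite size_nseq.
by case=> x; rewrite mem_nseq => /andP[_ /eqP ->] /andP[]; rewrite /=; lra.
Qed.

(** The lower bounds only use coverage of the two ends: 0 needs a sensor not beyond [r], and [L] one
    not before [L - r]. *)
Definition low (R : realType) (r : R) (c : config R) : bool :=
  has (fun x => x <= r) (positions c).

Definition high (R : realType) (T : R) (c : config R) : bool :=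
  has (fun x => T <= x) (positions c).

Lemma complete_low (R : realType) (r : R) (I : instance R) (c : config R) :
  0 <= barrier I -> complete r I c -> low r c.
Proof.
move=> L0 cc; have [|x xc /andP[x0 _]] := cc 0; first by rewrite lexx.
by apply/hasP; exists x => //; rewrite /= -subr_le0.
Qed.

Lemma complete_high (R : realType) (r : R) (I : instance R) (c : config R) :
  0 <= barrier I -> complete r I c -> high (barrier I - r) c.
Proof.
move=> L0 cc; have [|x xc /andP[_ x0]] := cc (barrier I);
  first by rewrite lexx L0.
by apply/hasP; exists x => //; rewrite /= lerBlDr.
Qed.

Lemma has_positions_walk (R : realType) (P : pred R) (c : config R) (z : R) :
  has P (positions (walk c z)) ->
  has P (positions c) \/ (0 < carried c)%N /\ P z.
Proof.
rewrite !has_cat !has_nseq /= => /orP[/andP[k0 Pz]|->]; first by right.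
by left; rewrite orbT.
Qed.

(* All the sensors start at d. The disjunction in hauled_both says which end of
   the barrier, 0 or L = T + r, was supplied first. *)
Record hauled (R : realType) (r d T : R) (c : config R) : Prop := Hauled {
  hauled_pos : 0 <= pos c <= frontier c;
  hauled_turn : 2 * frontier c - pos c <= travelled c;
  hauled_carried : (0 < carried c)%N -> d <= frontier c;
  hauled_ground : forall x, x \in ground c -> x != d ->
    d <= frontier c /\ x <= frontier c;
  hauled_low : low r c -> 2 * d - 2 * r + pos c <= travelled c;
  hauled_both : low r c -> high T c ->
    (2 * d - 2 * r + 2 * T - pos c <= travelled c) \/
    (2 * T - 2 * r + pos c <= travelled c)
}.

(** A sensor at [T] or further is no longer at [d < T], so the robot has been there. *)
Lemma hauled_high (R : realType) (r d T : R) (c : config R) :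
  d < T -> hauled r d T c -> high T c -> T <= frontier c.
Proof.
move=> dT [/andP[_ pF] _ _ gF _ _] /hasP[x + Tx]; rewrite mem_cat => /orP[|xg].
  by rewrite mem_nseq => /andP[_ /eqP xp]; rewrite /= in Tx; rewrite xp in Tx;
    lra.
have [|_ xF] := gF x xg; first by apply: contraTneq Tx => ->; rewrite -ltNge.
exact: le_trans Tx xF.
Qed.

Lemma hauled_walk (R : realType) (r d T : R) (c : config R) (z : R) :
  r < T -> d < T -> 0 <= z -> hauled r d T c -> hauled r d T (walk c z).
Proof.
move=> rT dT z0 H; have hF := hauled_high dT H.
case: H => /andP[p0 pF] turn car gr lo bo.
have zp1 : z - pos c <= `|z - pos c| by apply: ler_norm.
have zp2 : pos c - z <= `|z - pos c| by rewrite distrC; apply: ler_norm.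
have FF : frontier c <= Num.max (frontier c) z by rewrite le_max lexx.
split => //=.
- by rewrite z0 le_max lexx orbT.
- by case: (leP (frontier c) z) => Fz; lra.
- by move=> /car; lra.
- by move=> x xg xd; have [] := gr x xg xd; lra.
- case/has_positions_walk => [/lo|[/car dF zr]]; first lra.
  by rewrite /= in zr; lra.
(* Each end was supplied before this walk or is supplied by it; the walk cannot supply both, since
   [r < T]. *)
- move=> lw hw; have [l|[k zr]] := has_positions_walk lw;
    have [h|[k' zT]] := has_positions_walk hw.
  + by case: (bo l h) => ?; [left|right]; lra.
  + by left; have := lo l; rewrite /= in zT; lra.
  + by right; have := hF h; rewrite /= in zr; lra.
  + by rewrite /= in zr zT; lra.
Qed.

Lemma hauled_perform (R : realType) (r d T lim : R) (c : config R)
    (a : action R) :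
  r < T -> d < T -> hauled r d T c -> hauled r d T (perform lim c a).
Proof.
move=> rT dT H.
case: (perform_positions lim c a) => [[z z0 ->]|[pE FE tE pp]].
  exact: hauled_walk.
have lE : low r (perform lim c a) = low r c.
  by rewrite /low (perm_has _ pp).
have hE : high T (perform lim c a) = high T c.
  by rewrite /high (perm_has _ pp).
case: H => pc turn car gr lo bo; split; rewrite ?pE ?FE ?tE ?lE ?hE //.
- case: a {pE FE tE pp lE hE} => [y||] //=; last first.
    by case E: (carried c) => [|k] /=; [rewrite E|move=> _; apply: car;
      rewrite E].
  case: ifP => // pg _; have [<-|pd] := eqVneq (pos c) d;
    first by case/andP: pc.
  by case: (gr _ pg pd).
- case: a {pE FE tE pp lE hE} => [y||] //=.
    by case: ifP => // pg x /mem_rem; apply: gr.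
  case E: (carried c) => [|k] //= x; have /andP[_ pF] := pc.
  have dF : d <= frontier c by apply: car; rewrite E.
  by rewrite inE => /predU1P[->|/gr//] _.
Qed.

Lemma hauled_start (R : realType) (r d T L : R) (n : nat) :
  r < d -> hauled r d T (start (pile d n L)).
Proof.
move=> rd; have nl : ~~ low r (start (pile d n L)).
  apply/hasPn => x; rewrite mem_cat /= mem_nseq => /andP[_ /eqP ->].
  by rewrite -ltNge.
split=> //=; rewrite ?lexx ?mulr0 ?subrr //; try by rewrite (negbTE nl).
by move=> x; rewrite mem_nseq => /andP[_ ->].
Qed.

Lemma offline_hauled (R : realType) (r d L : R) (n : nat)
    (q : seq (action R)) :
  0 < r -> r < d -> d < L - r ->
  hauled r d (L - r) (offline_run (pile d n L) q).
Proof.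
move=> r0 rd dT; elim/last_ind: q => [|q a IH]; first exact: hauled_start.
rewrite /offline_run -cats1 foldl_cat /=; apply: hauled_perform => //; lra.
Qed.

Lemma pile_offline_lower_bound (R : realType) (r d L : R) (n : nat)
    (q : seq (action R)) :
  0 < r -> r < d -> d < L - r ->
  complete r (pile d n L) (offline_run (pile d n L) q) ->
  2 * d - 2 * r + (L - r) <= offline_length (pile d n L) q \/
  2 * (L - r) - r <= offline_length (pile d n L) q.
Proof.
move=> r0 rd dT cq; have H := offline_hauled n q r0 rd dT.
have L0 : 0 <= barrier (pile d n L) by rewrite /=; lra.
have lq := complete_low L0 cq; have hq := complete_high L0 cq.
have TF := hauled_high dT H hq; case: H => _ turn _ _ /(_ lq) lo /(_ lq hq) bo.
(* Averaging eliminates the final position: the first alternative is combined with [lo], the second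
   with [turn] and [T <= frontier]. *)
by rewrite /offline_length; case: bo => bo; [left|right]; lra.
Qed.

(** * Optimal offline trajectories for a pile *)

Definition place (R : realType) (zs : seq R) : seq (action R) :=
  flatten [seq [:: Move z; Drop] | z <- zs].

(** The sign [s], used with 1 and -1, lets one statement serve monotone placements in both
    directions; the lengths telescope. *)
Lemma place_run (R : realType) (lim s : R) (zs : seq R) (c : config R) :
  {in zs, forall z, 0 <= z <= lim} -> (size zs <= carried c)%N ->
  path (fun a b => `|b - a| == s * (b - a)) (pos c) zs ->
  let c' := foldl (perform lim) c (place zs) in
  travelled c' = travelled c + s * (last (pos c) zs - pos c) /\
  {subset zs ++ ground c <= ground c'}.
Proof.
elim: zs c => [|z zs IH] c zlim sz; first by split;
  rewrite //= subrr mulr0 addr0.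
move=> /= /andP[/eqP zE pz].
have /andP[z0 zl] := zlim z (mem_head _ _).
rewrite (min_l zl) (max_r z0) /=; case E: (carried c) sz => [|k] //= sz.
have [|//|//|-> sub] := IH (Config z (Num.max (frontier c) z)
  (travelled c + `|z - pos c|) k (z :: ground c)).
  by move=> x xz; apply: zlim; rewrite inE xz orbT.
split; first by rewrite /= zE -addrA -mulrDr; congr (_ + _ * _); lra.
move=> x xz; apply: sub; move: xz; rewrite /= !(inE, mem_cat).
by case/or3P => ->; rewrite /= ?orbT.
Qed.

Lemma pickup_pile (R : realType) (lim d t : R) (m k : nat) :
  foldl (perform lim) (Config d d t k (nseq m d)) (nseq m PickUp) =
  Config d d t (k + m) [::].
Proof.
elim: m k => [|m IH] k /=; first by rewrite addn0.
by rewrite mem_head eqxx IH addnS.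
Qed.

Lemma path_sign (R : realType) (s x : R) (zs : seq R) (e : rel R) :
  (forall a b, e a b -> `|b - a| = s * (b - a)) -> path e x zs ->
  path (fun a b => `|b - a| == s * (b - a)) x zs.
Proof. by move=> es; apply: sub_path => a b /es /eqP. Qed.

Lemma spots_below (R : realType) (r T : R) (n : nat) :
  r < T -> T <= spot r n ->
  exists2 N, (0 < N <= n)%N &
    T <= spot r N /\ {in gtn N, forall i, spot r i < T}.
Proof.
move=> rT Tn; have ex : exists N, T <= spot r N by exists n.
exists (ex_minn ex); case: ex_minnP => N TN Nmin.
  rewrite Nmin // andbT lt0n; apply: contraTneq TN => ->.
  by rewrite spot0 -ltNge.
by split=> // i; rewrite inE /= ltnNge; apply: contraNlt => /Nmin.
Qed.

Lemma spots_sorted (R : realType) (r T : R) (N : nat) :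
  0 < r -> {in gtn N, forall i, spot r i < T} ->
  sorted <=%R (rcons (map (spot r) (iota 0 N)) T).
Proof.
move=> r0 NT; rewrite -cats1 sorted_pairwise; last exact: le_trans.
rewrite pairwise_cat /= andbT allrel1r; apply/andP; split.
  apply/allP => x /mapP[i]; rewrite mem_iota add0n => /andP[_ iN] ->.
  by rewrite ltW // NT.
rewrite -sorted_pairwise; last exact: le_trans.
apply: homo_sorted (iota_sorted 0 N) => i j ij; by rewrite ler_spot.
Qed.

(** The routes [0, d, r, L - r] and [0, d, L - r, r] attain the two alternatives of the offline
    lower bound, so the shorter one is optimal. *)
Lemma pile_optimal (R : realType) (r d L : R) (n : nat) :
  0 < r -> r < d -> d < L - r -> L <= 2 * r * n%:R ->
  exists p, [/\ optimal_offline r (pile d n L) p,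
    L - r <= offline_length (pile d n L) p,
    offline_length (pile d n L) p <= 2 * d - 2 * r + (L - r) &
    offline_length (pile d n L) p <= 2 * (L - r) - r].
Proof.
move=> r0 rd dT Ln.
(* Using at most [n.-1] spots leaves a sensor for [L - r]. *)
have [N /andP[N0 Nn] [TN NT]] : exists2 N, (0 < N <= n.-1)%N &
    L - r <= spot r N /\ {in gtn N, forall i, spot r i < L - r}.
  apply: spots_below; first lra.
  have n0 : (0 < n)%N.
    by rewrite lt0n; apply: contraTneq Ln => ->; rewrite mulr0 -ltNge; lra.
  by move: Ln; rewrite -[in n%:R](prednK n0) -natr1 spotE; lra.
have Nn' : (N.+1 <= n)%N by lia.
pose S := map (spot r) (iota 0 N).
have sS : sorted <=%R (rcons S (L - r)) by apply: spots_sorted.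
have SL z : z \in rcons S (L - r) -> 0 <= z <= L.
  rewrite mem_rcons inE => /predU1P[->|/mapP[i]]; first by lra.
  rewrite mem_iota add0n => /andP[_ iN] ->; have := NT i iN.
  have : 0 < spot r i by rewrite mulr_gt0.
  lra.
have szS : size (rcons S (L - r)) = N.+1.
  by rewrite size_rcons size_map size_iota.
have SE : S = r :: map (spot r) (iota 1 N.-1).
  by rewrite /S -{1}(prednK N0) /= spot0.
have comp c : {subset rcons S (L - r) <= ground c} -> complete r (pile d n L) c.
  move=> sub y; apply: (spots_end_cover (N := N)) => //.
    move=> i iN; rewrite mem_cat sub ?orbT // mem_rcons inE map_f ?orbT //.
    by rewrite mem_iota.
  by rewrite mem_cat sub ?orbT // mem_rcons mem_head.
pose back := [:: Move d] ++ nseq n PickUp ++ [:: Move r] ++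
  place (rcons S (L - r)).
pose forth := [:: Move d] ++ nseq n PickUp ++ [:: Move (L - r)] ++
  place (rev (rcons S (L - r))).
have runE zs z : 0 <= z <= L ->
  offline_run (pile d n L) ([:: Move d] ++ nseq n PickUp ++ [:: Move z] ++ zs) =
  foldl (perform L) (walk (Config d d d n [::]) z) zs.
  move=> /andP[z0 zL]; rewrite /offline_run /start !foldl_cat /=.
  rewrite (@min_l _ _ d L) ?(@max_r _ _ 0 d); [|lra|lra].
  have -> : walk (start (pile d n L)) d = Config d d d 0 (nseq n d).
    rewrite /walk /= max_r ?add0r ?subr0 ?ger0_norm //; lra.
  by rewrite pickup_pile add0n (min_l zL) (max_r z0).
have [backC backL] : complete r (pile d n L) (offline_run (pile d n L) back) /\
    offline_length (pile d n L) back = 2 * d - 2 * r + (L - r).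
  rewrite /offline_length runE; last by lra.
  have [|||tE sub] :=
    @place_run R L 1 (rcons S (L - r)) (walk (Config d d d n [::]) r).
  - exact: SL.
  - by rewrite szS.
  - apply: (@path_sign _ _ _ _ <=%R); first by move=> a b ab;
      rewrite mul1r ger0_norm ?subr_ge0.
    by move: sS; rewrite SE /= lexx.
  split; first by apply: comp => z zS; apply: sub; rewrite mem_cat zS.
  rewrite tE /= last_rcons distrC ger0_norm; lra.
have [forthC forthL] :
    complete r (pile d n L) (offline_run (pile d n L) forth) /\
    offline_length (pile d n L) forth = 2 * (L - r) - r.
  rewrite /offline_length runE; last by lra.
  have [|||tE sub] :=
    @place_run R L (-1) (rev (rcons S (L - r)))
      (walk (Config d d d n [::]) (L - r)).
  - by move=> z; rewrite mem_rev; apply: SL.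
  - by rewrite size_rev szS.
  - apply: (@path_sign _ _ _ _ (fun a b => b <= a)).
      by move=> a b ab; rewrite mulN1r ler0_norm ?subr_le0.
    have : sorted (fun a b => b <= a) (rev (rcons S (L - r))).
      by rewrite rev_sorted.
    by rewrite rev_rcons /= lexx.
  split; first by apply: comp => z zS; apply: sub; rewrite mem_cat mem_rev zS.
  rewrite tE SE rev_rcons rev_cons /= last_rcons ger0_norm; lra.
have lower := @pile_offline_lower_bound R r d L n _ r0 rd dT.
have [bf|fb] :=
  leP (offline_length (pile d n L) back) (offline_length (pile d n L) forth).
  exists back; split; [split=> // q /lower|..]; lra.
exists forth; split; [split=> // q /lower|..]; lra.
Qed.

(** * The adversary *)

Lemma frontier_perform (R : realType) (lim : R) (c : config R) (a : action R) :
  frontier c <= frontier (perform lim c a).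
Proof.
case: (perform_positions lim c a) => [[z _ ->]|[_ ->]//].
by rewrite /= le_max lexx.
Qed.

Lemma online_runS (R : realType) (A : algorithm R) (I : instance R) (k : nat) :
  (online_run A I k.+1).1 =
  perform (horizon I (online_run A I k).1) (online_run A I k).1
    (A (online_run A I k).2).
Proof. by rewrite /=; case: (online_run A I k). Qed.

Lemma frontier_online (R : realType) (A : algorithm R) (I : instance R)
    (j k : nat) :
  (j <= k)%N ->
  frontier (online_run A I j).1 <= frontier (online_run A I k).1.
Proof.
move=> /subnK <-; elim: (k - j)%N => // m IH.
by rewrite addSn online_runS (le_trans IH) // frontier_perform.
Qed.

(** Both sides are the minimum of [L], [L'] and the undiscovered sensors, so the horizons agree
    below both ends. *)
Lemma min_horizon (R : realType) (L L' : R) (s s' : seq R) (c : config R) :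
  Num.min (horizon (Instance L s) c) L' =
  Num.min (horizon (Instance L' s') c) L.
Proof.
rewrite /horizon /=; elim: (ground c) => [|x g IH].
  by rewrite !big_nil minC.
by rewrite !big_cons; case: ifP => // _; rewrite -!minA IH.
Qed.

Lemma perform_agree (R : realType) (L L' : R) (s s' : seq R) (c : config R)
    (a : action R) :
  let c' := perform (horizon (Instance L s) c) c a in
  frontier c' < L -> frontier c' < L' ->
  perform (horizon (Instance L' s') c) c a = c'.
Proof.
case: a => //= y; set h := horizon _ c; set h' := horizon _ c.
rewrite !gt_max => /andP[_ /andP[L0 yL]] /andP[_ /andP[L'0 yL']].
have mh : Num.min h L' = Num.min h' L by apply: min_horizon.
suff -> : Num.min y h' = Num.min y h by [].
move: yL yL'; set m := Num.min y h => yL yL'.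
have : Num.min (Num.min y h') L = m.
  by rewrite -minA -mh minA -/m min_l // ltW.
by case: (leP (Num.min y h') L) => // _ Lm; rewrite Lm ltxx in yL.
Qed.

(** A deterministic robot cannot distinguish the two barriers before its frontier reaches an end of
    one of them. *)
Lemma online_agree (R : realType) (A : algorithm R) (L L' : R) (s : seq R)
    (k : nat) :
  let c := (online_run A (Instance L s) k).1 in
  frontier c < L -> frontier c < L' ->
  online_run A (Instance L' s) k = online_run A (Instance L s) k.
Proof.
elim: k => [|k IH] /= .
  by move=> L0 L'0; rewrite /observe /= !leNgt L0 L'0.
move: IH; case: (online_run A (Instance L s) k) => c h /= IH.
set c' := perform _ _ _ => cL cL'.
have cc' : frontier c <= frontier c' by apply: frontier_perform.
rewrite IH ?(le_lt_trans cc') //.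
have -> : perform (horizon (Instance L' s) c) c (A h) = c'.
  exact: perform_agree.
by rewrite /observe /= !leNgt cL cL'.
Qed.

Lemma online_hauled (R : realType) (r d L : R) (n : nat) (A : algorithm R)
    (k : nat) :
  0 < r -> r < d -> d < L - r ->
  hauled r d (L - r) (online_run A (pile d n L) k).1.
Proof.
move=> r0 rd dT; elim: k => [|k IH]; first exact: hauled_start.
by rewrite online_runS; apply: hauled_perform => //; lra.
Qed.

(* The bound that holds once the beginning of the barrier has been supplied
   from beyond X. *)
Definition late (R : realType) (r X T : R) (c : config R) : Prop :=
  2 * X - 2 * r + pos c <= travelled c /\
  (T <= frontier c -> 2 * X - 2 * r + T <= travelled c).

Lemma late_walk (R : realType) (r X T : R) (c : config R) (z : R) :
  late r X T c -> late r X T (walk c z).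
Proof.
move=> [lp lF]; have zp : z - pos c <= `|z - pos c| by apply: ler_norm.
have zp0 := normr_ge0 (z - pos c); split=> /=; first lra.
by rewrite le_max => /orP[/lF|]; lra.
Qed.

Lemma late_perform (R : realType) (r X T lim : R) (c : config R)
    (a : action R) :
  late r X T c -> late r X T (perform lim c a).
Proof.
case: (perform_positions lim c a) => [[z _ ->]|[pE FE tE _]].
  exact: late_walk.
by rewrite /late pE FE tE.
Qed.

(** The first sensor brought to [[0, r]] arrives in the hands of a robot coming from beyond [r],
    after its frontier was reached; [turn] then bounds the length. *)
Lemma first_low (R : realType) (r d T X lim : R) (c : config R) (a : action R) :
  hauled r d T c -> ~~ low r c -> low r (perform lim c a) ->
  X <= frontier (perform lim c a) ->
  [/\ d <= frontier (perform lim c a), pos (perform lim c a) <= r &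
    2 * X - 2 * r + pos (perform lim c a) <= travelled (perform lim c a)].
Proof.
move=> [/andP[p0 pF] turn car _ _ _] nl.
case: (perform_positions lim c a) => [[z z0 ->]|[_ _ _ pp]]; last first.
  by rewrite /low (perm_has _ pp) => l; move: nl; rewrite /low l.
case/has_positions_walk => [l|[k zr]]; first by move: nl; rewrite /low l.
have zp : pos c - z <= `|z - pos c| by rewrite distrC; apply: ler_norm.
have pr : r < pos c.
  rewrite ltNge; apply: contra nl => pr; apply/hasP; exists (pos c) => //.
  by rewrite mem_cat mem_nseq k eqxx.
have dF := car k.
rewrite /= in zr *; rewrite max_l; last lra.
by move=> XF; split=> //; lra.
Qed.

(** * Lengths forced on the online robot *)

Lemma passes_through_frontier (R : realType) (A : algorithm R) (I : instance R)
    (k : nat) (z : R) :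
  z <= Num.max (pos (online_run A I k).1) (pos (online_run A I k.+1).1) ->
  pos (online_run A I k).1 <= frontier (online_run A I k).1 ->
  pos (online_run A I k.+1).1 <= frontier (online_run A I k.+1).1 ->
  frontier (walk (online_run A I k).1 z) <= frontier (online_run A I k.+1).1.
Proof.
move=> zm pF pF'; have FF := frontier_online A I (leqnSn k).
rewrite /= ge_max FF /= (le_trans zm) // ge_max pF' andbT.
exact: le_trans FF.
Qed.

(** After the return from [X] the robot must still supply the right end, hence get to [X + r]:
    [2 * X - 2 * r] plus [X + r]. *)
Lemma early_return_length (R : realType) (r d X : R) (n k : nat)
    (A : algorithm R) (t : R) :
  let I := pile d n (X + 2 * r) in
  0 < r -> r < d -> d <= X -> frontier (online_run A I k).1 = X ->
  pos (online_run A I k).1 <= r ->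
  2 * X - 2 * r + pos (online_run A I k).1 <=
    travelled (online_run A I k).1 ->
  completion_lengths r A I t -> 3 * X - r <= t.
Proof.
move=> I r0 rd dX FX pr tX [c [[j [z [/andP[zl zu] cE]]] cc] <-].
have T_eq : barrier I - r = X + r by rewrite /=; lra.
have hauledI i : hauled r d (X + r) (online_run A I i).1.
  by rewrite -T_eq; apply: online_hauled; rewrite //=; lra.
have posF i : 0 <= pos (online_run A I i).1 <= frontier (online_run A I i).1.
  by case: (hauledI i).
have z0 : 0 <= z.
  by apply: le_trans zl; rewrite le_min; have /andP[-> _] := posF j;
    have /andP[-> _] := posF j.+1.
have L0 : 0 <= barrier I by rewrite /=; lra.
have hc : X + r <= frontier c.
  apply: (@hauled_high R r d); first lra.
    by rewrite cE; apply: hauled_walk => //; lra.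
  by rewrite -T_eq; apply: complete_high.
(* Up to step [k] the frontier is at most [X], short of the required [X + r]. *)
have kj : (k <= j)%N.
  rewrite leqNgt; apply/negP => jk; have := frontier_online A I jk.
  have := passes_through_frontier zu; rewrite -cE FX.
  have /andP[_ pj] := posF j; have /andP[_ pj'] := posF j.+1.
  by move=> /(_ pj pj'); lra.
have [_ /(_ hc)] : late r X (X + r) c; last by lra.
rewrite cE; apply: late_walk; move: kj => /subnK <-.
elim: (j - k)%N => [|m IH]; first by split; rewrite // add0n FX; lra.
by rewrite addSn online_runS; apply: late_perform.
Qed.

Lemma late_return_length (R : realType) (r d L Y : R) (n : nat)
    (A : algorithm R) (t : R) :
  let I := pile d n L in
  0 < r -> r < d -> d < L - r ->
  (forall k, low r (online_run A I k).1 ->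
    Y <= frontier (online_run A I k).1) ->
  completion_lengths r A I t -> 2 * Y - 2 * r <= t.
Proof.
move=> I r0 rd dT lowY [c [[j [z [/andP[zl zu] cE]]] cc] <-].
have hauledI i : hauled r d (L - r) (online_run A I i).1.
  exact: online_hauled.
have lowT i : low r (online_run A I i).1 ->
    2 * Y - 2 * r + pos (online_run A I i).1 <= travelled (online_run A I i).1.
  elim: i => [|i IH].
    move=> /hasP[x]; rewrite mem_cat /= mem_nseq => /andP[_ /eqP ->]; lra.
  have [l _|nl l] := boolP (low r (online_run A I i).1).
    rewrite online_runS.
    have [[y _ ->]|[-> _ -> _]] :=
      perform_positions (horizon I (online_run A I i).1)
      (online_run A I i).1 (A (online_run A I i).2); last exact: IH.
    have := ler_norm (y - pos (online_run A I i).1); have := IH l; rewrite /=;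
      lra.
  move: l (lowY _ l); rewrite online_runS => l Yl.
  by case: (first_low (hauledI i) nl l Yl).
have L0 : 0 <= barrier I by rewrite /=; lra.
have lc := complete_low L0 cc; rewrite cE in lc *.
set a := (online_run A I j).1 in zl zu lc *.
set b := (online_run A I j.+1).1 in zl zu.
have [/andP[pa0 paF] turn _ _ _ _] := hauledI j; rewrite -/a in pa0 paF turn.
have [/andP[pb0 _] _ _ _ _ _] := hauledI j.+1; rewrite -/b in pb0.
have z0 : 0 <= z by apply: le_trans zl; rewrite le_min pa0.
have nz : pos a - z <= `|z - pos a| by rewrite distrC; apply: ler_norm.
have nz' : z - pos a <= `|z - pos a| by apply: ler_norm.
have [la|na] := boolP (low r a); first by have := lowT j la; rewrite -/a /=;
  lra.
have [la|[k zr]] := has_positions_walk lc; first by move: na; rewrite /low la.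
rewrite /= in zr.
have pr : r < pos a.
  rewrite ltNge; apply: contra na => pr; apply/hasP; exists (pos a) => //.
  by rewrite mem_cat mem_nseq k eqxx.
have bz : pos b <= z by move: zl; rewrite ge_min leNgt (le_lt_trans zr pr).
have bE : b = walk a (pos b).
  move: bz; rewrite /b online_runS -/a.
  have [[y _ ->] //|[-> _ _ _] az] :=
    perform_positions (horizon I a) a (A (online_run A I j).2).
  by exfalso; lra.
(* Completion may occur in mid-move, whereas [lowY] speaks of ends of moves; this move to the left
   ends at [b], also within [r] of 0 and with the same frontier. *)
have : Y <= frontier b.
  apply: lowY; rewrite -/b bE; apply/hasP; exists (pos b);
    last exact: le_trans zr.
  by rewrite mem_cat mem_nseq k eqxx.
by rewrite bE /= max_l; lra.
Qed.

(** The optimum is at least [L - r], so an error of [eps * (L - r)] is affordable; it is also at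
    most the length of either candidate route. *)
Lemma ratio_bound (R : realType) (r eps d L B : R) (n : nat) (A : algorithm R) :
  0 < r -> 0 < eps -> r < d -> d < L - r -> L <= 2 * r * n%:R ->
  restores_coverage r A ->
  (forall t, completion_lengths r A (pile d n L) t -> B <= t) ->
  3 / 2 * (2 * d - 2 * r + (L - r)) <= B + eps * (L - r) \/
  3 / 2 * (2 * (L - r) - r) <= B + eps * (L - r) ->
  ((3 / 2 - eps)%:E <= competitive_ratio r A)%E.
Proof.
move=> r0 e0 rd dT Ln rA tB BU.
have adm : admissible r (pile d n L) by apply: pile_admissible => //; lra.
have [p [opt Tp pU1 pU2]] := pile_optimal r0 rd dT Ln.
apply: le_trans (ereal_sup_ubound _); last by exists (pile d n L), p.
have Bon : B <= online_length r A (pile d n L).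
  by apply: lb_le_inf; [exact: rA|exact: tB].
have p0 : 0 < offline_length (pile d n L) p by lra.
rewrite lee_fin ler_pdivlMr // mulrBl.
have eT : eps * (L - r) <= eps * offline_length (pile d n L) p.
  by rewrite ler_pM2l.
by case: BU => BU; lra.
Qed.

Lemma competitive_ratio_lower_bound (R : realType) (r eps : R)
    (A : algorithm R) :
  0 < r -> 0 < eps -> restores_coverage r A ->
  ((3 / 2 - eps)%:E <= competitive_ratio r A)%E.
Proof.
move=> r0 e0 rA.
(* This gives [eps * d > 3 * r], enough to absorb the errors of order [r]. *)
pose d := 3 * r / eps + 2 * r.
have q0 : 0 < 3 * r / eps by rewrite divr_gt0 // mulr_gt0.
have rd : r < d by rewrite /d; lra.
have ed : eps * d = 3 * r + 2 * (eps * r).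
  by rewrite /d mulrDr mulrCA divff ?gt_eqF // mulr1 mulrCA.
have er0 : 0 < eps * r by rewrite mulr_gt0.
clearbody d.
(* One [n] fits every barrier length the adversary may choose, all at most [8 * d + 2 * r]. *)
pose n := Num.bound ((8 * d + 2 * r) / (2 * r)).
have Ln : 8 * d + 2 * r <= 2 * r * n%:R.
  rewrite [leRHS]mulrC -ler_pdivrMr ?mulr_gt0 // ltW // /n.
  by apply: archi_boundP; rewrite divr_ge0; lra.
clearbody n; pose I := pile d n (8 * d + r).
pose early k :=
  low r (online_run A I k).1 && (frontier (online_run A I k).1 < 8 * d).
have [ex|nex] := pselect (exists k, early k); last first.
  apply: (@ratio_bound _ r eps d (8 * d + r) (16 * d - 2 * r) n) => //;
    first lra.
  - lra.
  - have -> : 16 * d = 2 * (8 * d) by lra.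
    move=> t; apply: late_return_length => //; first lra.
    move=> k lk; rewrite leNgt; apply/negP => kF; apply: nex; exists k.
    by rewrite /early lk.
  (* Here [3 / 2 * (10 * d - 2 * r) = 15 * d - 3 * r] is below [16 * d - 2 * r]. *)
  - left; have : 0 < eps * (8 * d + r - r) by apply: mulr_gt0 => //; lra.
    lra.
have [[|k] /andP[lk kF] kmin] := ex_minnP ex.
  by move: lk => /hasP[x]; rewrite mem_cat /= mem_nseq => /andP[_ /eqP ->];
    rewrite leNgt rd.
set X := frontier (online_run A I k.+1).1 in kF.
have FF := frontier_online A I (leqnSn k); rewrite -/X in FF.
have nlk : ~~ low r (online_run A I k).1.
  apply/negP => l; have := kmin k; rewrite /early l (le_lt_trans FF kF) ltnn.
  by move=> /(_ isT).
have hk : hauled r d (8 * d + r - r) (online_run A I k).1.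
  by apply: online_hauled => //; lra.
have [] := first_low (X := X) hk nlk _ _ (lim := horizon I (online_run A I k).1)
  (a := A (online_run A I k).2); rewrite -?online_runS // -/X.
move=> dX pr tX.
(* The frontier [X] is short of both ends, so the end may be chosen after seeing the robot
   return. *)
have agree : online_run A (pile d n (X + 2 * r)) k.+1 = online_run A I k.+1.
  by apply: online_agree; rewrite -/X; lra.
apply: (@ratio_bound _ r eps d (X + 2 * r) (3 * X - r) n) => //.
- lra.
- lra.
- move=> t; apply: (@early_return_length _ r d X n k.+1) => //;
    rewrite agree //.
(* The gap between [3 / 2 * (2 * X + r)] and [3 * X - r] is [5 / 2 * r], less than [eps * d]. *)
- right; have : eps * d <= eps * X by rewrite ler_pM2l.
  have -> : eps * (X + 2 * r - r) = eps * X + eps * r by lra.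
  lra.
Qed.

Theorem theorem2 (R : realType) (r : R) (r_gt0 : 0 < r) :
  (forall eps : R, 0 < eps ->
     forall A : algorithm R, restores_coverage r A ->
       ((3 / 2 - eps)%:E <= competitive_ratio r A)%E) /\
  (exists A : algorithm R,
     restores_coverage r A /\ (competitive_ratio r A <= (3 / 2)%:E)%E).
Proof.
split=> [eps eps_gt0 A rA|]; first exact: competitive_ratio_lower_bound.
exists (sweep r); split; first exact: sweep_restores.
exact: sweep_competitive_ratio.
Qed.
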